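(* Let $(\Omega,\Sigma)$ be a measurable space and let $\mu$ be a measure on $(\Omega,\Sigma)$. The following statements are equivalent: (a) $\mu$ is weakly localizable; (b) for every measure $\nu$ on $(\Omega,\Sigma)$, if the pair $(\mu,\nu)$ is compatible on $(\Omega,\Sigma)$, then the pair $(\mu,\nu)$ satisfies the Radon-Nikodym property.
   Context: A measurable space $(\Omega,\Sigma)$ is a set $\Omega$ with a $\sigma$-algebra $\Sigma$ of subsets of $\Omega$. A measure is a $\sigma$-additive function $\mu:\Sigma\to[0,+\infty]$ with $\mu(\emptyset)=0$ (no finiteness, $\sigma$-finiteness or semi-finiteness is assumed). For a measure $\mu$ put $\mathcal{N}_\mu=\{A\in\Sigma:\mu(A)=0\}$ and $\mathcal{F}_\mu=\{A\in\Sigma:\mu(A)<+\infty\}$; similarly for $\nu$. A function $f:\Omega\to[-\infty,\infty]$ is measurable if $\{f>t\}\in\Sigma$ for every $t\in\mathbb{R}$. $\mu$-supremum: a set $A\in\Sigma$ is a $\mu$-supremum of a family $\mathcal{E}\subseteq\Sigma$ if (1) for every $E\in\mathcal{E}$, $E\setminus A\in\mathcal{N}_\mu$; and (2) whenever $B\in\Sigma$ is such that $B\cap E\in\mathcal{N}_\mu$ for every $E\in\mathcal{E}$, then $B\cap A\in\mathcal{N}_\mu$. Weakly localizable: the measure $\mu$ (i.e. $(\Omega,\Sigma,\mu)$) is weakly localizable if every family $\mathcal{E}\subseteq\mathcal{F}_\mu$ has a $\mu$-supremum. Compatible: for measures $\mu,\nu$ on $(\Omega,\Sigma)$, the pair $(\mu,\nu)$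 is compatible on $(\Omega,\Sigma)$ if for every $A\in\Sigma$ with $0<\nu(A)<+\infty$ there exists $B\in\Sigma$ with $B\subseteq A$, $0<\nu(B)$ and $0<\mu(B)<+\infty$. Radon-Nikodym property: the pair $(\mu,\nu)$ satisfies the Radon-Nikodym property if there exists a measurable function $g:\Omega\to[0,\infty]$ such that $\nu(A)=\int_A g\,d\mu$ for every $A\in\mathcal{F}_\nu$. *)

(* Defs.v *)
From HB Require Import structures.
From mathcomp Require Import all_boot all_order all_algebra.
From mathcomp Require Import all_classical all_reals all_analysis.
From mathcomp Require Import measurable_realfun.

Set Implicit Arguments.
Unset Strict Implicit.
Unset Printing Implicit Defensive.

Import Order.TTheory GRing.Theory Num.Theory.
Import numFieldNormedType.Exports.
Local Open Scope classical_set_scope.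
Local Open Scope ring_scope.
Local Open Scope ereal_scope.

Section weakly_localizable.
Context (d : measure_display) (T : measurableType d) (R : realType).
Implicit Types mu nu : {measure set T -> \bar R}.

(* A library measure is a function on all of [set T], constrained (apart from
   nonnegativity) only on measurable sets; so measurability is required
   explicitly in the definitions below. *)

Definition measure_zero_sets mu : set (set T) :=
  [set A | measurable A /\ mu A = 0].

Definition measure_finite_sets mu : set (set T) :=
  [set A | measurable A /\ mu A < +oo].

Definition measure_supremum mu (E : set (set T)) (A : set T) : Prop :=
  [/\ measurable A,
      forall F, E F -> measure_zero_sets mu (F `\` A)
    & forall B, measurable B ->
        (forall F, E F -> measure_zero_sets mu (B `&` F)) ->
        measure_zero_sets mu (B `&` A)].

Definition weakly_localizable mu : Prop :=
  forall E : set (set T), E `<=` measure_finite_sets mu ->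
    exists A : set T, measure_supremum mu E A.

Definition compatible mu nu : Prop :=
  forall A, measurable A -> 0 < nu A < +oo ->
    exists B, [/\ measurable B, B `<=` A, 0 < nu B & 0 < mu B < +oo].

Definition Radon_Nikodym_property mu nu : Prop :=
  exists g : T -> \bar R,
    [/\ measurable_fun [set: T] g,
        forall x, 0 <= g x
      & forall A, measure_finite_sets nu A -> nu A = \int[mu]_(x in A) g x].

End weakly_localizable.

(* Main.v *)
Require Import Defs.
From HB Require Import structures.
From mathcomp Require Import all_boot all_order all_algebra.
From mathcomp Require Import all_classical all_reals all_analysis.
From mathcomp Require Import measurable_realfun.

Set Implicit Arguments.
Unset Strict Implicit.
Unset Printing Implicit Defensive.

Import Order.TTheory GRing.Theory Num.Theory.
Import numFieldNormedType.Exports.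
Local Open Scope classical_set_scope.
Local Open Scope ring_scope.
Local Open Scope ereal_scope.

(** From weak localizability to Radon-Nikodym.  A candidate density [g] of [nu]
is determined by its superlevel sets, and a set [P] of finite [mu]-measure
should lie in [{g >= q}] exactly when [q * mu X <= nu X] for every measurable
[X] inside [P].  For a fixed [q] these sets [P] form a possibly uncountable
family, and weak localizability supplies a supremum [A_q] of it.  Put
[g := sup q * 1_(A_q)] over a countable dense set of levels [q >= 0].  Then [g]
agrees [mu]-almost everywhere with any density that [nu] has on any set of
finite [nu]-measure ([weakly_localizable_common_density]), so it suffices to
produce densities locally.  If [nu A] is finite, an exhaustion argument
([measure_sup_attained]) applied to the sets on which [g] is a density yields
such a set [F] with [nu (A `&` F)] maximal.  If [nu (A `\` F)] were positive,
compatibility would give a piece of [A `\` F] of positive [nu]-measure and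
finite [mu]-measure, on which the classical theorem for finite measures gives a
density; adding it to [F] would contradict maximality.  So [A `\` F] is
[nu]-null.  It may have infinite [mu]-measure, but [0] is a density of [nu] on
it, hence so is [g].

From Radon-Nikodym to weak localizability.  Given a family [E] of sets of finite
[mu]-measure, let [nu A] be the supremum of [mu (A `&` F)] where [F] runs over
the sets that are [mu]-essentially covered by [E], meaning that a measurable set
meeting every member of [E] in a null set meets [F] in a null set.  These [F]
are closed under countable unions, which makes [nu] a measure
([sup_restrictions_measure]); it coincides with [mu] inside each member of [E],
and it vanishes on the sets meeting every member of [E] in a null set.  It is
compatible with [mu], and if [g] is the resulting density then [{g > 0}] is a
[mu]-supremum of [E]: the part of a member of [E] where [g = 0] has measure
[0], and [g] vanishes almost everywhere on a set where [nu] is zero. *)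

(** * Suprema of restrictions of a measure *)

Section sup_restrictions.
Context (d : measure_display) (T : measurableType d) (R : realType).
Implicit Types (mu nu : {measure set T -> \bar R}) (D : set (set T)).

Definition countable_union_closed D : Prop :=
  [/\ D `<=` measurable, D set0
    & forall F : (set T)^nat, (forall n, D (F n)) -> D (\bigcup_n F n)].

(** The union of a maximizing sequence stays in the class, so exhaustion
arguments reach the supremum even when it is infinite. *)
Lemma measure_sup_attained mu D (A : set T) :
  countable_union_closed D -> measurable A ->
  exists2 F, D F & forall G, D G -> mu (A `&` G) <= mu (A `&` F).
Proof.
move=> [mD D0 DU] mA.
have /ereal_sup_seq[u uS ucvg] : [set mu (A `&` F) | F in D] != set0.
  by apply/set0P; exists (mu (A `&` set0)), set0.
have /choice[F /all_and2[DF uE]] :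
    forall n, exists F, D F /\ mu (A `&` F) = u n.
  by move=> n; have [F DF <-] := uS n; exists F.
have mAF G : D G -> measurable (A `&` G).
  by move=> /mD mG; exact: measurableI.
exists (\bigcup_n F n); first exact: DU.
move=> G DG; apply: (@le_trans _ _ (ereal_sup [set mu (A `&` F) | F in D])).
  by apply: ereal_sup_ubound; exists G.
rewrite -(cvg_lim _ ucvg)//; apply: lime_le.
  by apply/cvg_ex; eexists; exact: ucvg.
apply: nearW => n; rewrite -uE le_measure ?inE//; first exact: mAF.
  exact/mAF/DU.
by apply: setIS; exact: bigcup_sup.
Qed.

(** A supremum of measures is in general not additive; here the suprema over the
pieces of a disjoint union are attained, and the union of the sets attaining
them serves all the pieces at once. *)
Lemma sup_restrictions_measure mu D : countable_union_closed D ->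
  exists nu : {measure set T -> \bar R},
    forall A, nu A = ereal_sup [set mu (A `&` F) | F in D].
Proof.
move=> Dc; have [mD D0 DU] := Dc.
pose nu A := ereal_sup [set mu (A `&` F) | F in D].
have nu_ub A F : D F -> mu (A `&` F) <= nu A.
  by move=> DF; apply: ereal_sup_ubound; exists F.
have nu_ge0 A : 0 <= nu A.
  by apply: le_trans (nu_ub A _ D0); exact: measure_ge0.
have nu0 : nu set0 = 0.
  apply/eqP; rewrite eq_le nu_ge0 andbT.
  by apply: ge_ereal_sup => _ [F _ <-]; rewrite set0I measure0.
have nu_sigma : semi_sigma_additive nu.
  move=> F mF tF mUF.
  have muUF G : D G -> mu (\bigcup_n F n `&` G) = \sum_(i <oo) mu (F i `&` G).
    move=> /mD mG; have mFG i : measurable (F i `&` G) by exact: measurableI.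
    rewrite setI_bigcupl measure_semi_bigcup//; last exact: bigcupT_measurable.
    exact: trivIset_setIr.
  have -> : nu (\bigcup_n F n) = \sum_(i <oo) nu (F i).
    apply/eqP; rewrite eq_le; apply/andP; split.
      apply: ge_ereal_sup => _ [G DG <-]; rewrite muUF//.
      by apply: lee_nneseries => i *; [exact: measure_ge0|exact: nu_ub].
    have /choice[G /all_and2[DG nuG]] :
        forall i, exists G, D G /\ nu (F i) <= mu (F i `&` G).
      move=> i; have [G DG Gmax] := measure_sup_attained mu Dc (mF i).
      by exists G; split=> //; apply: ge_ereal_sup => _ [H DH <-]; exact: Gmax.
    have DUG : D (\bigcup_n G n) by exact: DU.
    apply: le_trans (nu_ub _ _ DUG); rewrite muUF//.
    apply: lee_nneseries => // i _; apply: le_trans (nuG i) _.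
    rewrite le_measure ?inE//; first exact/measurableI/mD/DG.
      exact/measurableI/mD.
    by apply: setIS; exact: bigcup_sup.
  by apply: is_cvg_ereal_nneg_natsum_cond => n _ _; exact: nu_ge0.
pose nu_measure := isMeasure.Build _ _ _ nu nu0 nu_ge0 nu_sigma.
by exists (HB.pack_for {measure set T -> \bar R} nu nu_measure).
Qed.

(** The measure that has to be differentiated is the part of [mu] carried by
[E]; its density with respect to [mu] plays the role of the indicator function
of the union of [E]. *)
Lemma Radon_Nikodym_property_weakly_localizable mu :
  (forall nu : {measure set T -> \bar R},
     compatible mu nu -> Radon_Nikodym_property mu nu) ->
  weakly_localizable mu.
Proof.
move=> RN E Efin.
pose misses B := forall F, E F -> measure_zero_sets mu (B `&` F).
(* The largest class that behaves like the countable unions of members of [E]: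
   it is closed under countable unions without any enumeration of them. *)
pose D := [set F | measurable F /\
  forall B, measurable B -> misses B -> mu (B `&` F) = 0].
have mE F : E F -> measurable F by case/Efin.
have DE F : E F -> D F.
  by move=> EF; split=> [|B mB /(_ F EF)[]]//; exact: mE.
have Dc : countable_union_closed D.
  split=> [F []//||F /all_and2[mF F0]].
    by split=> // B _ _; rewrite setI0 measure0.
  split=> [|B mB EB]; first exact: bigcupT_measurable.
  have mBF i : measurable (B `&` F i) by exact: measurableI.
  rewrite setI_bigcupr; apply/negligibleP; first exact: bigcupT_measurable.
  by apply: negligible_bigcup => i; apply/negligibleP => //; exact: F0.
have [nu nuE] := sup_restrictions_measure mu Dc.
have nu_ub A F : D F -> mu (A `&` F) <= nu A.
  by move=> DF; rewrite nuE; apply: ereal_sup_ubound; exists F.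
have nu_sub A F : measurable A -> E F -> A `<=` F -> nu A = mu A.
  move=> mA EF AF; apply/eqP; rewrite eq_le; apply/andP; split.
    rewrite nuE; apply: ge_ereal_sup => _ [G [mG _] <-].
    by rewrite le_measure ?inE//; exact: measurableI.
  by rewrite -[in leLHS](setIidl AF); exact/nu_ub/DE.
have nu_miss B : measurable B -> misses B -> nu B = 0.
  move=> mB EB; apply/eqP; rewrite eq_le measure_ge0 andbT nuE.
  by apply: ge_ereal_sup => _ [F [mF /(_ B mB EB)->] <-].
have cnu : compatible mu nu.
  move=> A mA /andP[nuA0 _].
  have [F EF AF0] : exists2 F, E F & mu (A `&` F) != 0.
    apply: contrapT => /forall2NP AE0; move: nuA0.
    rewrite nu_miss ?ltxx// => F EF.
    split; first exact/measurableI/mE.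
    by have [//|/negP/negPn/eqP] := AE0 F.
  have mAF : measurable (A `&` F) by exact/measurableI/mE.
  exists (A `&` F); split=> //.
    by rewrite (@nu_sub _ F)// lt0e AF0 measure_ge0.
  rewrite lt0e AF0 measure_ge0/=.
  apply: le_lt_trans (Efin F EF).2.
  by rewrite le_measure ?inE//; exact: mE.
have [g [mg g0 nug]] := RN nu cnu.
have mA : measurable [set x | 0 < g x].
  by rewrite -[X in measurable X]setTI; exact: emeasurable_fun_o_infty.
exists [set x | 0 < g x]; split=> // [F EF|B mB EB].
  have mF := mE F EF.
  have mFA : measurable (F `\` [set x | 0 < g x]) by exact: measurableD.
  have nuFA := nu_sub _ F mFA EF (@subDsetl _ _ _).
  split=> //; rewrite -nuFA nug.
    apply: integral0_eq => x [_ /= /negP].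
    by rewrite -leNgt => gx0; apply/eqP; rewrite eq_le gx0 g0.
  split=> //; rewrite nuFA; apply: le_lt_trans (Efin F EF).2.
  by rewrite le_measure ?inE//; exact: subDsetl.
have mBA : measurable (B `&` [set x | 0 < g x]) by exact: measurableI.
split=> //; apply/negligibleP => //.
have : \int[mu]_(x in B) `|g x| = 0.
  under eq_integral do rewrite gee0_abs//.
  by rewrite -nug ?nu_miss//; split=> //; rewrite nu_miss.
move/ae_eq_integral_abs => /(_ mB (measurable_funTS mg)).
apply: negligibleS => x [Bx /= gx0] /(_ Bx) gx.
by rewrite gx ltxx in gx0.
Qed.

End sup_restrictions.

(** * Densities, local and global *)

Section densities.
Context (d : measure_display) (T : measurableType d) (R : realType).
Implicit Types (mu nu : {measure set T -> \bar R}) (g h : T -> \bar R).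

Definition density_on mu nu (F : set T) g : Prop :=
  forall X, measurable X -> X `<=` F -> nu X = \int[mu]_(x in X) g x.

Lemma density_on_exists mu nu (F : set T) :
  measurable F -> mu F < +oo -> nu F < +oo ->
  (forall X, measurable X -> X `<=` F -> mu X = 0 -> nu X = 0) ->
  exists h, [/\ measurable_fun [set: T] h, forall x, 0 <= h x
              & density_on mu nu F h].
Proof.
move=> mF muF nuF numu.
pose muF_ : {finite_measure set T -> \bar R} := mfrestr mF muF.
pose nuF_ : {finite_measure set T -> \bar R} := mfrestr mF nuF.
have [|h [h0 /integrableP[mh _] nuh]] := @radon_nikodym_finite _ _ _ muF_ nuF_.
  apply/null_content_dominatesP => X mX; apply: numu; first exact: measurableI.
  exact: subIsetr.
exists h; split=> // X mX XF.
have -> : nu X = nuF_ X by rewrite /= /mfrestr /mrestr setIidl.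
rewrite nuh//; apply: eq_measure_integral => Y mY YX.
by rewrite /= /mfrestr /mrestr setIidl//; exact: subset_trans XF.
Qed.

(** This puts the sets on which [g] is a density within reach of the exhaustion
argument. *)
Lemma density_on_countable_union_closed mu nu g :
  measurable_fun [set: T] g -> (forall x, 0 <= g x) ->
  countable_union_closed [set F | measurable F /\ density_on mu nu F g].
Proof.
move=> mg g0; split=> [F []//||F /all_and2[mF nuF]].
  by split=> // X _; rewrite subset0 => ->; rewrite measure0 integral_set0.
split=> [|X mX XF]; first exact: bigcupT_measurable.
pose G := seqDU (fun n => X `&` F n).
have mXF n : measurable (X `&` F n) by exact: measurableI.
have mG n : measurable (G n) by exact: seqDU_measurable.
have tG : trivIset setT G by exact: trivIset_seqDU.
have -> : X = \bigcup_n G n.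
  by rewrite -seqDU_bigcup_eq -setI_bigcupr setIidl.
rewrite measure_semi_bigcup//; last exact: bigcupT_measurable.
rewrite ge0_integral_bigcup//; last exact: measurable_funTS.
apply: eq_eseriesr => n _; apply: (nuF n) => //.
by move=> x [[]].
Qed.

Lemma nneg_dense_sequence : exists q : R^nat, (forall n, (0 <= q n)%R) /\
  forall a b : \bar R, 0 <= a -> a < b -> exists n, a < (q n)%:E < b.
Proof.
exists (fun n => if unpickle n is Some r then ratr `|r : rat|%R else 0%R).
split=> [n|a b a0 ab]; first by case: unpickle => // r; rewrite ler0q normr_ge0.
case: a a0 ab => [a| |] a0 ab //; last by rewrite ltNge leey in ab.
rewrite lee_fin in a0.
have [c ac cb] : exists2 c : R, (a < c)%R & c%:E <= b.
  case: b ab => [b| |] ab //; first by exists b.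
  by exists (a + 1)%R; rewrite ?ltrDl ?leey.
have [r /[!in_itv]/= /andP[ar rc]] := rat_in_itvoo ac.
exists (pickle r); rewrite pickleK ger0_norm; last first.
  by rewrite -(ler0q R) (le_trans a0)// ltW.
by rewrite lte_fin ar/= (lt_le_trans _ cb)// lte_fin.
Qed.

(** Since local densities are compared with [g] only almost everywhere on their
own domains, they need no prior gluing: all of them are recovered from the
suprema [A n] of the families [E n], in which they do not occur.  Bounding
[nu F] rather than [mu F] lets the conclusion reach [nu]-null sets of infinite
[mu]-measure, with [h = 0]. *)
Lemma weakly_localizable_common_density mu nu : weakly_localizable mu ->
  exists g, [/\ measurable_fun [set: T] g, forall x, 0 <= g x
    & forall F h, measurable F -> nu F < +oo ->
        measurable_fun [set: T] h -> (forall x, 0 <= h x) ->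
        density_on mu nu F h -> density_on mu nu F g].
Proof.
move=> wl; have [q [q0 q_dense]] := nneg_dense_sequence.
pose E n := [set P | [/\ measurable P, mu P < +oo &
  forall X, measurable X -> X `<=` P -> (q n)%:E * mu X <= nu X]].
have /choice[A Asup] n : exists A, measure_supremum mu (E n) A.
  by apply: wl => P [].
have mA n : measurable (A n) by have [] := Asup n.
pose s n x : \bar R := (q n * \1_(A n) x)%:E.
pose g x := ereal_sup (range (s ^~ x)).
have g_ub n x : A n x -> (q n)%:E <= g x.
  move=> Ax; apply: ereal_sup_ubound; exists n => //.
  by rewrite /s indicE mem_set// mulr1.
have g0 x : 0 <= g x.
  apply: (@le_trans _ _ (s 0%N x)); last by apply: ereal_sup_ubound; exists 0%N.
  by rewrite lee_fin mulr_ge0.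
have g_gt a x : 0 <= a -> a < g x -> exists2 n, A n x & a < (q n)%:E.
  move=> a0 /ereal_sup_gt[_ [n _ <-]]; rewrite /s indicE.
  case: (boolP (x \in A n)) => [/set_mem Ax|_]; first by rewrite mulr1; exists n.
  by rewrite mulr0 ltNge a0.
have mg : measurable_fun [set: T] g.
  have -> : g = fun x => esups (s ^~ x) 0%N.
    apply/funext => x; congr ereal_sup.
    by apply/seteqP; split=> _ [n _ <-]; exists n.
  apply: measurable_fun_esups => n; apply/measurable_EFinP.
  by apply: measurable_funM => //; exact: measurable_indic.
exists g; split=> // F h mF nuF mh h0 nuh.
have mFh (P : set (\bar R)) : measurable P -> measurable (F `&` h @^-1` P).
  by move=> mP; exact: (measurable_funTS mh).
(* [F `&` {h > q n}] belongs to [E n]: its [mu]-measure is at most [nu F / q n],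
   which is where the strict positivity of [q n] enters. *)
have low n : (0 < q n)%R -> mu ((F `&` [set x | (q n)%:E < h x]) `\` A n) = 0.
  move=> qn0; have [_ /(_ (F `&` [set x | (q n)%:E < h x])) sup1 _] := Asup n.
  have mP : measurable (F `&` [set x | (q n)%:E < h x]).
    exact: emeasurable_fun_o_infty (measurable_funTS mh) _.
  have Pq X : measurable X -> X `<=` F `&` [set x | (q n)%:E < h x] ->
      (q n)%:E * mu X <= nu X.
    move=> mX XP; rewrite nuh//; last by move=> x /XP[].
    rewrite -integral_cst//; apply: ge0_le_integral => //.
    - by move=> x _; rewrite lee_fin.
    - exact: measurable_funTS.
    - by move=> x /XP[_ /ltW].
  apply: (sup1 _).2; split=> //.
  have /le_lt_trans/(_ nuF) :
      (q n)%:E * mu (F `&` [set x | (q n)%:E < h x]) <= nu F.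
    apply: (le_trans (Pq _ mP _)) => //.
    by rewrite le_measure ?inE//; exact: subIsetl.
  apply: contraTT; rewrite -!leNgt !leye_eq => /eqP->.
  by rewrite gt0_muley ?lte_fin.
(* On the part [X] of [F `&` {h <= q m}] inside a member of [E n],
   [q n * mu X <= nu X <= q m * mu X] with [mu X] finite, hence [mu X = 0]. *)
have high n m : (q m < q n)%R ->
    mu ((F `&` [set x | h x <= (q m)%:E]) `&` A n) = 0.
  move=> qmn; have [_ _ sup2] := Asup n.
  have mB : measurable (F `&` [set x | h x <= (q m)%:E]).
    exact: emeasurable_fun_infty_c (measurable_funTS mh) _.
  apply: (sup2 _ mB _).2 => P [mP muP Pq].
  set X := _ `&` P; have mX : measurable X by exact: measurableI.
  split=> //; apply/eqP; rewrite eq_le measure_ge0 andbT leNgt; apply/negP => X0.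
  have muX : mu X < +oo.
    by apply: le_lt_trans muP; rewrite le_measure ?inE//; exact: subIsetr.
  have : (q n)%:E * mu X <= (q m)%:E * mu X.
    apply: le_trans (Pq _ mX (@subIsetr _ _ _)) _.
    rewrite nuh//; last by move=> x [[]].
    rewrite -integral_cst//; apply: ge0_le_integral => //.
    - exact: measurable_funTS.
    - by move=> x [[]].
  by rewrite lee_pmul2r ?ge0_fin_numE// lee_fin leNgt qmn.
have gh : ae_eq mu F g h.
  have lowae : \forall x \ae mu, forall n, (0 < q n)%R -> F x ->
      (q n)%:E < h x -> A n x.
    apply: ae_foralln => n.
    have [qn0|qn0] := ltP 0%R (q n); last by apply: nearW.
    exists ((F `&` [set x | (q n)%:E < h x]) `\` A n); split; [|exact: low|].
      apply: measurableD => //.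
      exact: emeasurable_fun_o_infty (measurable_funTS mh) _.
    move=> x /= nAx; split=> [|Ax]; last exact: nAx.
    by split; apply: contrapT => nFx; apply: nAx.
  have highae : \forall x \ae mu, forall n m, (q m < q n)%R -> F x ->
      A n x -> (q m)%:E < h x.
    apply: ae_foralln => n; apply: ae_foralln => m.
    have [qmn|qmn] := ltP (q m) (q n); last by apply: nearW.
    exists ((F `&` [set x | h x <= (q m)%:E]) `&` A n); split; [|exact: high|].
      apply: measurableI => //.
      exact: emeasurable_fun_infty_c (measurable_funTS mh) _.
    move=> x /= nhx; split; last by apply: contrapT => nAx; apply: nhx.
    split; first by apply: contrapT => nFx; apply: nhx.
    by rewrite leNgt; apply/negP => hx; apply: nhx.
  apply: filterS2 lowae highae => x lowx highx Fx.
  apply/eqP; rewrite eq_le; apply/andP; split; rewrite leNgt; apply/negP.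
    move=> /(g_gt _ _ (h0 x))[n Ax] /(q_dense _ _ (h0 x))[m /andP[hm]].
    by rewrite lte_fin => mn; move: (highx n m mn Fx Ax); rewrite ltNge ltW.
  move=> /(q_dense _ _ (g0 x))[n /andP[gn nh]].
  have qn0 : (0 < q n)%R by rewrite -lte_fin; exact: le_lt_trans gn.
  by have := g_ub n x (lowx n qn0 Fx nh); rewrite leNgt gn.
move=> X mX XF; rewrite nuh//; apply: ge0_ae_eq_integral => //.
- exact: measurable_funTS.
- exact: measurable_funTS.
- by apply: filterS gh => x + /XF => /[apply].
Qed.

(** Compatibility enters twice: it makes [nu] absolutely continuous with respect
to [mu] on sets of finite [nu]-measure, and it provides the pieces of finite
[mu]-measure that exhaust them. *)
Lemma weakly_localizable_Radon_Nikodym_property mu nu :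
  weakly_localizable mu -> compatible mu nu -> Radon_Nikodym_property mu nu.
Proof.
move=> wl cmn.
have [g [mg g0 nug]] := weakly_localizable_common_density nu wl.
exists g; split=> // A [mA nuA].
have nu_fin X : measurable X -> X `<=` A -> nu X < +oo.
  by move=> mX XA; apply: le_lt_trans nuA; rewrite le_measure ?inE.
have null_density X : measurable X -> X `<=` A -> mu X = 0 -> nu X = 0.
  move=> mX XA muX; apply/eqP; rewrite -measure_le0 leNgt; apply/negP => nuX.
  have [|B [mB BX _]] := cmn X mX; first by rewrite nuX nu_fin.
  by rewrite (subset_measure0 mB mX BX muX) ltxx.
have Dc := density_on_countable_union_closed mu nu mg g0.
set D := [set F | _] in Dc; have [mD D0 DU] := Dc.
have [F DF Fmax] := measure_sup_attained nu Dc mA.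
have mF := mD _ DF; have mAF : measurable (A `\` F) by exact: measurableD.
have nuAF : nu (A `\` F) = 0.
  apply/eqP; rewrite -measure_le0 leNgt; apply/negP => nuAF.
  have [|B [mB BAF nuB /andP[_ muB]]] := cmn _ mAF.
    by rewrite nuAF nu_fin//; exact: subDsetl.
  have BA : B `<=` A by move=> x /BAF[].
  have [|h [mh h0 nuh]] := density_on_exists mB muB (nu_fin _ mB BA).
    by move=> X mX XB; apply: null_density => //; exact: subset_trans BA.
  have DB : D B by split=> //; apply: nug nuh => //; exact: nu_fin.
  have DFB : D (F `|` B).
    by rewrite -bigcup2E; apply: DU => -[|[|n]].
  have nuAFfin : nu (A `&` F) \is a fin_num.
    rewrite ge0_fin_numE//; apply: nu_fin; first exact: measurableI.
    exact: subIsetl.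
  have := Fmax _ DFB; rewrite setIUr (setIidr BA) measureU//.
  - by rewrite leNgt lteDl// nuB.
  - exact: measurableI.
  - by apply/seteqP; split=> // x [[_ Fx] /BAF[_]].
(* The remainder may be large for [mu], but the zero function is a density of
   [nu] on it. *)
have DAF : D (A `\` F).
  split=> //; apply: (nug _ (cst 0)) => //; first by rewrite nuAF.
  by move=> X mX XAF; rewrite integral0; exact: subset_measure0 nuAF.
have [_] : D (F `|` (A `\` F)) by rewrite -bigcup2E; apply: DU => -[|[|n]].
apply=> // x Ax; have [Fx|Fx] := pselect (F x); [by left|by right].
Qed.

End densities.

Theorem theorem5p1 (d : measure_display) (T : measurableType d) (R : realType)
    (mu : {measure set T -> \bar R}) :
  weakly_localizable mu <->
  (forall nu : {measure set T -> \bar R},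
     compatible mu nu -> Radon_Nikodym_property mu nu).
Proof.
split=> [wl nu|]; first exact: weakly_localizable_Radon_Nikodym_property.
exact: Radon_Nikodym_property_weakly_localizable.
Qed.
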